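(* Let $d\ge3$, $T\subset\mathbb R$ with $|T|=n\ge d+1$, and let $P_\sigma(T)$ be a Veronese $d$-polytope whose signed $\sigma$-decomposition partitions $T$ into $d+1$ intervals $T=I_1\cup\dots\cup I_{d+1}$. If $|I_1|=\dots=|I_d|=1$ and $|I_{d+1}|=n-d$, then $P_\sigma(T)$ is a $d$-dimensional simplex.
   Context: $\nu_d(t)=(1,t,\dots,t^d)$, $q_\xi(t)=\sum_{i=0}^d\xi_it^i$. A chamber $\sigma$ is the closure of a connected component of the complement in $\mathbb R^{d+1}$ of the hyperplanes $\{\xi:q_\xi(t)=0\}$, $t\in T$; $P_\sigma(T)=\mathrm{conv}\{\nu_d(t)/q_\xi(t):t\in T\}$ for any $\xi$ in the interior of $\sigma$ (combinatorial type independent of this choice). The signed $\sigma$-decomposition partitions $T$ into the maximal runs $I_1<I_2<\dots$ (in increasing order) of consecutive elements of $T$ on which $\mathrm{sgn}\,q_\xi$ is constant. *)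

(* Defs.v *)
From HB Require Import structures.
From mathcomp Require Import all_boot all_order all_algebra.
From mathcomp Require Import finmap.
From mathcomp Require Import all_classical all_reals all_analysis.
Import Order.TTheory GRing.Theory Num.Theory.
Import numFieldNormedType.Exports.

Set Implicit Arguments.
Unset Strict Implicit.
Unset Printing Implicit Defensive.

Local Open Scope classical_set_scope.
Local Open Scope ring_scope.

Definition veronese (R : realType) (d : nat) (t : R) : 'rV[R]_d.+1 :=
  \row_(i < d.+1) t ^+ i.

Definition qpoly (R : realType) (d : nat) (xi : 'rV[R]_d.+1) (t : R) : R :=
  \sum_(i < d.+1) xi 0 i * t ^+ i.

Definition arrangement_complement (R : realType) (d : nat) (T : {fset R}) :
    set 'rV[R]_d.+1 :=
  ~` \bigcup_(t in [set` T]) [set xi | qpoly xi t = 0].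

Definition chamber (R : realType) (d : nat) (T : {fset R})
    (sigma : set 'rV[R]_d.+1) : Prop :=
  exists2 x, arrangement_complement T x &
    sigma = closure (connected_component (arrangement_complement T) x).

Definition convex_hull (R : realType) (V : lmodType R) (A : set V) : set V :=
  smallest (@convex_set R V) A.

(* [P] is [P_sigma(T)]. Different interior points [xi] of [sigma] give
   different (combinatorially equivalent) polytopes, hence a relation. *)
Definition veronese_polytope (R : realType) (d : nat) (T : {fset R})
    (sigma P : set 'rV[R]_d.+1) : Prop :=
  exists2 xi, interior sigma xi &
    P = convex_hull [set (qpoly xi t)^-1 *: veronese d t | t in [set` T]].

Definition sign_run (R : realType) (d : nat) (T : {fset R})
    (xi : 'rV[R]_d.+1) (J : {fset R}) : Prop :=
  [/\ J != fset0,
      (J `<=` T)%fset,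
      forall s t u, s \in J -> t \in J -> u \in T -> s <= u <= t -> u \in J
    & forall s t, s \in J -> t \in J ->
        Num.sg (qpoly xi s) = Num.sg (qpoly xi t)].

Definition maximal_sign_run (R : realType) (d : nat) (T : {fset R})
    (xi : 'rV[R]_d.+1) (J : {fset R}) : Prop :=
  sign_run T xi J /\
  forall K : {fset R}, sign_run T xi K -> (J `<=` K)%fset -> K = J.

(* The maximal runs are exactly [I 0 < I 1 < ... < I (k - 1)]; they cover [T]
   because each [t] in [T] lies in a maximal run. The signs on [T] are the same
   for all interior points [xi] of a chamber [sigma]. *)
Definition signed_decomposition (R : realType) (d : nat) (T : {fset R})
    (sigma : set 'rV[R]_d.+1) (k : nat) (I : 'I_k -> {fset R}) : Prop :=
  exists2 xi, interior sigma xi &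
    [/\ forall i, maximal_sign_run T xi (I i),
        forall J, maximal_sign_run T xi J -> exists i, J = I i
      & forall (i j : 'I_k) s t, (i < j)%N -> s \in I i -> t \in I j -> s < t].

Definition affinely_independent (R : realType) (V : lmodType R) (k : nat)
    (v : 'I_k -> V) : Prop :=
  forall a : 'I_k -> R,
    \sum_(i < k) a i = 0 -> \sum_(i < k) a i *: v i = 0 -> forall i, a i = 0.

Definition simplex (R : realType) (V : lmodType R) (k : nat) (P : set V) :
    Prop :=
  exists2 v : 'I_k.+1 -> V, affinely_independent v & P = convex_hull (range v).

(* Main.v *)
Require Import Defs.
From HB Require Import structures.
From mathcomp Require Import all_boot all_order all_algebra.
From mathcomp Require Import finmap zify ring.
From mathcomp Require Import all_classical all_reals all_analysis.
Import Order.TTheory GRing.Theory Num.Theory.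
Import numFieldNormedType.Exports.

(* Let [t_1 < ... < t_d] be the points of the singleton runs and [t_(d+1)] the
   least point of the last run; the signs of [q = q_xi] alternate along the
   [t_i]. A point [u >= t_(d+1)] of the last run satisfies
   [nu(u) = sum_i L_i(u) nu(t_i)] with [L_i] the Lagrange basis polynomials, and
   the sign of [L_i(u)] is [(-1)^(d+1-i)] or 0, so that
   [L_i(u) q(t_i) / q(u) >= 0]. Interpolating [q] shows that these weights sum
   to 1, hence [nu(u) / q(u)] lies in the convex hull of the [nu(t_i) / q(t_i)],
   which are linearly independent by the Vandermonde determinant. *)

Set Implicit Arguments.
Unset Strict Implicit.
Unset Printing Implicit Defensive.

Local Open Scope classical_set_scope.
Local Open Scope ring_scope.

(* [Defs.qpoly] is qualified throughout because [all_algebra] shadows [qpoly]. *)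

Lemma qpoly_continuous (R : realType) (d : nat) (t : R) :
  continuous (fun xi : 'rV[R]_d.+1 => Defs.qpoly xi t).
Proof.
move=> x; rewrite /Defs.qpoly.
pose P (f : 'rV[R]_d.+1 -> R) := {for x, continuous f}.
have -> : (fun xi : 'rV[R]_d.+1 => \sum_(i < d.+1) xi 0 i * t ^+ i) =
    \sum_(i < d.+1) (fun xi : 'rV[R]_d.+1 => xi 0 i * t ^+ i).
  by apply/funext => xi; rewrite fct_sumE.
apply: (big_ind P) => [|f g fx gx|i _]; first exact: cst_continuous.
  exact: continuousD.
apply: continuousM; [exact: coord_continuous|exact: cst_continuous].
Qed.

Lemma qpoly_delta0 (R : realType) (d : nat) (xi : 'rV[R]_d.+1) (c t : R) :
  Defs.qpoly (xi + c *: delta_mx 0 0) t = Defs.qpoly xi t + c.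
Proof.
rewrite /Defs.qpoly !big_ord_recl !mxE !eqxx expr0 !mulr1 addrAC; congr (_ + _ + _).
by apply: eq_bigr => i _; rewrite !mxE eqxx /= mulr0 addr0.
Qed.

(** The values of [qpoly _ t] on [C] form an interval that avoids 0. The product in the conclusion
    encodes equality of the two strict signs. *)
Lemma sgr_qpoly_connected (R : realType) (d : nat) (t : R)
    (C : set 'rV[R]_d.+1) (x y : 'rV[R]_d.+1) :
    connected C -> (forall z, C z -> Defs.qpoly z t != 0) -> C x -> C y ->
  0 < Num.sg (Defs.qpoly x t) * Defs.qpoly y t.
Proof.
move=> Cc C0 Cx Cy.
have qC : is_interval [set Defs.qpoly z t | z in C].
  apply/connected_intervalP/connected_continuous_connected => //.
  exact/continuous_subspaceT/qpoly_continuous.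
have no0 a b : C a -> C b -> Defs.qpoly a t < 0 -> 0 < Defs.qpoly b t -> False.
  move=> Ca Cb a0 b0.
  have [] := qC _ _ (ex_intro2 _ _ a Ca erefl) (ex_intro2 _ _ b Cb erefl) 0.
    by rewrite (ltW a0) (ltW b0).
  by move=> z Cz z0; move: (C0 z Cz); rewrite z0 eqxx.
case: (ltrgtP (Defs.qpoly y t) 0) => [y0|y0|y0].
- case: (ltrgtP (Defs.qpoly x t) 0) => [x0|x0|x0].
  + by rewrite ltr0_sg // mulN1r oppr_gt0.
  + by have := no0 _ _ Cy Cx y0 x0.
  + by move: (C0 x Cx); rewrite x0 eqxx.
- case: (ltrgtP (Defs.qpoly x t) 0) => [x0|x0|x0].
  + by have := no0 _ _ Cx Cy x0 y0.
  + by rewrite gtr0_sg // mul1r.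
  + by move: (C0 x Cx); rewrite x0 eqxx.
- by move: (C0 y Cy); rewrite y0 eqxx.
Qed.

(** The polytope and the decomposition may use different interior points of the chamber; a common
    sign function [s] carries signs from one to the other. *)
Lemma chamber_sgr (R : realType) (d : nat) (T : {fset R})
    (sigma : set 'rV[R]_d.+1) : chamber T sigma ->
  exists2 s : R -> R, {in T, forall t, s t != 0} &
    forall xi, interior sigma xi ->
      {in T, forall t, Num.sg (Defs.qpoly xi t) = s t}.
Proof.
move=> [x Tx ->].
set C := connected_component _ x.
have C0 t : t \in T -> forall z, C z -> Defs.qpoly z t != 0.
  move=> tT z /connected_component_sub zT; apply/eqP => z0.
  by apply: zT; exists t.
have Cx : C x by exact: connected_component_refl.
exists (fun t => Num.sg (Defs.qpoly x t)) => [t tT|xi xiC t tT].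
  by rewrite sgr_eq0; exact: C0 tT _ Cx.
set s := Num.sg (Defs.qpoly x t).
have s0 : s != 0 by rewrite sgr_eq0; exact: C0 tT _ Cx.
(* The strict sign on the component is weakened to a closed condition, which passes to the
   closure. *)
have Cge0 : closure C `<=` [set z | 0 <= s * Defs.qpoly z t].
  have/closure_id -> : closed [set z : 'rV[R]_d.+1 | 0 <= s * Defs.qpoly z t].
    apply: (@preimage_closed _ _ (fun z : 'rV[R]_d.+1 => s * Defs.qpoly z t)
      [set a | 0 <= a]); last exact: closed_ge.
    move=> y _ /=; apply: (@continuousM _ _ (fun=> s) (fun z => Defs.qpoly z t));
      [exact: cst_continuous|exact: qpoly_continuous].
  apply: closureS => y Cy; apply: ltW.
  apply: (sgr_qpoly_connected (@component_connected _ _ _) _ Cx Cy).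
  exact: C0.
(* [xi] is interior, so the constant coefficient can be moved to lower [s * q(t)]
   by a positive amount while staying in the closed chamber. *)
have [e e0 xie] : exists2 e, 0 < e & closure C (xi + (- s * e) *: delta_mx 0 0).
  have : (fun e : R => xi + (- s * e) *: delta_mx 0 0) @ 0
      --> xi + (- s * 0) *: delta_mx 0 0.
    apply: cvgD; first exact: cvg_cst.
    by apply: cvgZr_tmp; apply: cvgM; [exact: cvg_cst|exact: cvg_id].
  rewrite mulr0 scale0r addr0.
  move=> /(_ _ xiC) /nbhs_ballP[e /= e0 /(_ (e / 2)) nearC];
    exists (e / 2); first by rewrite divr_gt0.
  apply: nearC; rewrite /ball /= sub0r normrN gtr0_norm ?divr_gt0 //.
  by rewrite ltr_pdivrMr // ltr_pMr // ltr1n.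
have s2 : s * s = 1 by rewrite -expr2 sqr_sg -sgr_eq0 s0.
have := Cge0 _ xie; rewrite /= qpoly_delta0 mulrDr mulNr mulrN mulrA s2 mul1r.
rewrite subr_ge0 => /(lt_le_trans e0) /gtr0_sg; rewrite sgrM sgr_id => sq.
by rewrite -[LHS]mul1r -s2 -mulrA sq mulr1.
Qed.

(** * Convex combinations and hulls *)

Lemma convex_hull_convex (R : realType) (V : lmodType R) (A : set V) :
  convex_set (convex_hull A).
Proof.
move=> x y l; rewrite !inE => xA yA B [Bconv AB].
have xB : x \in (B : set (convex_lmodType V)) by rewrite inE; exact: xA.
have yB : y \in (B : set (convex_lmodType V)) by rewrite inE; exact: yA.
by have := Bconv x y l xB yB; rewrite inE.
Qed.

(** Induction splits off the last point. Partial weights need not sum to 1, so the claim proved by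
    induction allows any positive total and divides by it. *)
Lemma convex_set_sum (R : realType) (V : lmodType R) (A : set V) (k : nat)
    (w : 'I_k -> R) (v : 'I_k -> V) : convex_set A ->
    (forall i, 0 <= w i) -> (forall i, A (v i)) -> \sum_(i < k) w i = 1 ->
  A (\sum_(i < k) w i *: v i).
Proof.
move=> cA.
suff sumA : forall k (w : 'I_k -> R) (v : 'I_k -> V),
    (forall i, 0 <= w i) -> (forall i, A (v i)) -> 0 < \sum_(i < k) w i ->
    A ((\sum_(i < k) w i)^-1 *: \sum_(i < k) w i *: v i).
  move=> w0 vA w1; have := sumA k w v w0 vA.
  by rewrite w1 invr1 scale1r; apply; exact: ltr01.
elim=> {k w v} [|k IHk] w v w0 vA; first by rewrite !big_ord0 ltxx.
rewrite !big_ord_recr /=.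
set w' := fun i => w (widen_ord (leqnSn k) i).
have : 0 <= \sum_(i < k) w' i by apply: sumr_ge0 => i _; exact: w0.
(* If the first [k] weights sum to 0, they all vanish and only the last point remains. *)
rewrite le_eqVlt => /predU1P[S0|S0].
  have w'0 i : w' i = 0.
    apply/eqP; have := psumr_eq0P (fun i _ => w0 (widen_ord (leqnSn k) i)) (esym S0).
    by rewrite /w' => ->.
  rewrite -S0 [X in _ *: (X + _)]big1 => [|i _]; last by rewrite -/(w' i) w'0 scale0r.
  by rewrite !add0r => w1; rewrite scalerA mulVf ?scale1r ?gt_eqF.
move=> Sw; set S := \sum_(i < k) _ in S0 Sw *.
set x := \sum_(i < k) _.
have Ax : A (S^-1 *: x) by apply: IHk => // i; exact: w0.
(* This is the weight of the normalized partial sum [S^-1 *: x] against [v ord_max]. *)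
have l0 : 0 <= S / (S + w ord_max) by rewrite divr_ge0 ?ltW.
have l1 : S / (S + w ord_max) <= 1.
  by rewrite ler_pdivrMr // mul1r lerDl.
have := cA (S^-1 *: x) (v ord_max) (Itv01 l0 l1).
rewrite !inE => /(_ Ax (vA _)) /=.
rewrite [X in A X -> _](_ : _ = (S / (S + w ord_max)) *: (S^-1 *: x) +
  (1 - S / (S + w ord_max)) *: v ord_max) //.
rewrite scalerA scalerDr scalerA; congr (A (_ *: _ + _ *: _)).
  by rewrite mulrAC divff ?mul1r ?gt_eqF.
by rewrite -[1](@divff _ (S + w ord_max)) ?gt_eqF // -mulrBl addrAC subrr add0r mulrC.
Qed.

Lemma convex_hull_eq (R : realType) (V : lmodType R) (A B : set V) :
  A `<=` B -> B `<=` convex_hull A -> convex_hull B = convex_hull A.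
Proof.
move=> AB BA; apply/seteqP; split.
  by apply: smallest_sub => //; exact: convex_hull_convex.
by apply: sub_smallest2r => //; exact: convex_hull_convex.
Qed.

(** * Lagrange interpolation and the Vandermonde determinant *)

Definition lagrange_coef (R : fieldType) (k : nat) (t : 'I_k -> R)
    (i : 'I_k) (u : R) : R :=
  \prod_(j < k | j != i) ((u - t j) / (t i - t j)).

(** The difference of [p] and its interpolant has size at most [k] and vanishes at [k] distinct
    nodes, so it is zero. *)
Lemma lagrange_interpolation (R : fieldType) (k : nat) (t : 'I_k -> R)
    (p : {poly R}) (u : R) : injective t -> (size p <= k)%N ->
  p.[u] = \sum_(i < k) lagrange_coef t i u * p.[t i].
Proof.
move=> t_inj sp.
pose L i : {poly R} := \prod_(j < k | j != i) ((t i - t j)^-1 *: ('X - (t j)%:P)).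
have LE i x : (L i).[x] = lagrange_coef t i x.
  rewrite horner_prod; apply: eq_bigr => j _.
  by rewrite hornerZ hornerXsubC mulrC.
have coefE i j : lagrange_coef t i (t j) = (i == j)%:R.
  rewrite /lagrange_coef; have [<-|ij] := eqVneq i j.
    by apply: big1 => l li; rewrite divff // subr_eq0 (inj_eq t_inj) eq_sym.
  by rewrite (bigD1 j) 1?eq_sym //= subrr !mul0r.
suff /eqP : p - \sum_(i < k) p.[t i] *: L i = 0.
  rewrite subr_eq0 => /eqP {1}->; rewrite horner_sum; apply: eq_bigr => i _.
  by rewrite hornerZ LE mulrC.
apply: (@roots_geq_poly_eq0 _ _ [seq t i | i <- enum 'I_k]).
- apply/allP => _ /mapP[j _ ->]; rewrite rootE hornerD hornerN horner_sum.
  rewrite (bigD1 j) //= big1 => [|i ij].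
    by rewrite hornerZ LE coefE eqxx mulr1 addr0 subrr.
  by rewrite hornerZ LE coefE (negPf ij) mulr0.
- by rewrite map_inj_uniq // enum_uniq.
rewrite size_map size_enum_ord (leq_trans (size_polyD _ _)) // geq_max sp size_polyN.
apply: (leq_trans (size_sum _ _ _)); apply/bigmax_leqP => i _.
apply: (leq_trans (size_scale_leq _ _)).
rewrite /L scaler_prod; apply: (leq_trans (size_scale_leq _ _)).
(* There are [k - 1] factors of size 2, so the product has size [2(k - 1) + 1 - (k - 1) = k]. *)
rewrite size_prod => [|j _]; last by rewrite polyXsubC_eq0.
rewrite (eq_bigr (fun=> (2 * 1)%N)) => [|j _]; last by rewrite size_XsubC.
rewrite -big_distrr /= sum1_card cardC1 card_ord mul2n -addnn.
by case: k i {t p u t_inj sp L LE coefE} => [[]//|k] _; rewrite /= -addSn addnK.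
Qed.

Lemma veronese_free (R : realType) (d : nat) (t : 'I_d.+1 -> R)
    (b : 'I_d.+1 -> R) : injective t ->
  \sum_(i < d.+1) b i *: veronese d (t i) = 0 -> forall i, b i = 0.
Proof.
move=> t_inj b0 i.
pose V := Vandermonde d.+1 (\row_i t i).
have uV : V \in unitmx.
  rewrite unitmxE det_Vandermonde unitfE.
  apply/prodf_neq0 => j _; apply/prodf_neq0 => l jl.
  by rewrite !mxE subr_eq0 (inj_eq t_inj) -val_eqE /= gtn_eqF.
suff : V *m (\col_j b j) = 0.
  move=> /(congr1 (mulmx (invmx V))); rewrite mulKmx // mulmx0 => /matrixP /(_ i 0).
  by rewrite !mxE.
apply/matrixP => k j; rewrite !mxE.
move/rowP: b0 => /(_ k); rewrite summxE !mxE => b0; rewrite -[RHS]b0.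
by apply: eq_bigr => l _; rewrite !mxE mulrC.
Qed.

(** * Maximal runs and their signs *)

Lemma maximal_sign_run_cover (R : realType) (d : nat) (T : {fset R})
    (xi : 'rV[R]_d.+1) (t : R) : t \in T ->
  exists2 J, maximal_sign_run T xi J & t \in J.
Proof.
move=> tT.
(* A run through [t] of largest cardinality is maximal for inclusion; the singleton shows that such
   runs exist. *)
pose P k := `[< exists J : {fset R}, [/\ sign_run T xi J, t \in J & #|` J| = k] >].
have exP : exists k, P k.
  exists 1%N; apply/asboolP; exists [fset t]%fset; split; last exact: cardfs1.
  - split.
    + by apply/fset0Pn; exists t; rewrite in_fset1.
    + by rewrite fsub1set.
    + move=> a b u; rewrite !in_fset1 => /eqP -> /eqP -> _.
      by rewrite -eq_le eq_sym.
    + by move=> a b; rewrite !in_fset1 => /eqP -> /eqP ->.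
  - by rewrite in_fset1.
have boundP k : P k -> (k <= #|` T|)%N.
  by move=> /asboolP[J [[_ JT _ _] _ <-]]; exact: fsubset_leq_card.
case: (ex_maxnP exP boundP) => k /asboolP[J [runJ tJ <-]] maxJ.
exists J => //; split => // K runK JK; apply/eqP; rewrite eq_sym eqEfcard JK.
by apply: maxJ; apply/asboolP; exists K; split => //; exact: (fsubsetP JK).
Qed.

(** If the signs agreed, the union of the two neighbouring runs would be a strictly larger run. *)
Lemma adjacent_runs_neq_sg (R : realType) (d : nat) (T : {fset R})
    (xi : 'rV[R]_d.+1) (k : nat) (I : 'I_k -> {fset R}) (i j : 'I_k) (s t : R) :
    (forall i, maximal_sign_run T xi (I i)) ->
    (forall J, maximal_sign_run T xi J -> exists i, J = I i) ->
    (forall (i j : 'I_k) s t, (i < j)%N -> s \in I i -> t \in I j -> s < t) ->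
    j = i.+1 :> nat -> s \in I i -> t \in I j ->
  Num.sg (Defs.qpoly xi s) != Num.sg (Defs.qpoly xi t).
Proof.
move=> runI allI ltI ji si tj; apply/eqP => sgst.
have [[Ii0 IiT _ sgi] maxi] := runI i; have [[_ IjT _ sgj] _] := runI j.
have run_ij : sign_run T xi (I i `|` I j)%fset.
  have sgK a : a \in (I i `|` I j)%fset ->
      Num.sg (Defs.qpoly xi a) = Num.sg (Defs.qpoly xi s).
    by rewrite in_fsetU => /orP[/sgi/(_ si)|/sgj/(_ tj)] // ->.
  split; last by move=> a b /sgK -> /sgK ->.
  - by apply/fset0Pn; exists s; rewrite in_fsetU si.
  - by rewrite fsubUset IiT IjT.
  (* The point [u] lies in some run [I l]. If [l < i] then [u < a], if [l > j] then [b < u], and no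
     index lies strictly between [i] and [j]. *)
  - move=> a b u aK bK uT /andP[au ub].
    have [_ /allI[l ->] ul] := maximal_sign_run_cover xi uT.
    rewrite in_fsetU; case: (ltngtP l i) => [li|il|/val_inj <-]; last by rewrite ul.
      have : u < a.
        move: aK; rewrite in_fsetU => /orP[] aI; apply: ltI ul aI => //.
        by rewrite ji (ltn_trans li).
      by rewrite ltNge au.
    case: (ltngtP l j) => [lj|jl|/val_inj <-]; last by rewrite ul orbT.
      by move: lj; rewrite ji ltnS leqNgt il.
    have : b < u.
      by move: bK; rewrite in_fsetU => /orP[] bI; apply: ltI bI ul.
    by rewrite ltNge ub.
(* Maximality of [I i] puts [t] in both runs, whence [t < t]. *)
have /fsetP /(_ t) := maxi _ run_ij (fsubsetUl _ _).
rewrite in_fsetU tj orbT => /esym ti.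
by have := ltI i j t t; rewrite ji ltxx => /(_ (ltnSn _) ti tj).
Qed.

(** * Alternating signs and the simplex *)

Lemma sgr_alternating (R : realDomainType) (d : nat) (a : 'I_d.+1 -> R) :
    (forall i j : 'I_d.+1, j = i.+1 :> nat -> Num.sg (a i) = - Num.sg (a j)) ->
  forall i, Num.sg (a i) = (\prod_(j < d.+1 | (i < j)%N) -1) * Num.sg (a ord_max).
Proof.
move=> alt i; move ek: (d - i)%N => k; elim: k i ek => [|k IHk] i dik.
  have -> : i = ord_max by apply: val_inj => /=; have := ltn_ord i; lia.
  rewrite big_pred0 ?mul1r // => j /=; have := ltn_ord j; lia.
have lt_id : (i.+1 < d.+1)%N by lia.
pose j := Ordinal lt_id.
rewrite (alt i j) // IHk /=; last lia.
rewrite [in RHS](bigD1 j) //= !mulN1r mulNr; congr (- (_ * _)).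
apply: eq_bigl => l; rewrite -val_eqE /=; lia.
Qed.

(** The sign [(-1)^(d - i)] is kept as a product over [j > i] so that each -1 pairs with one
    negative denominator [t i - t j]; all numerators [u - t j] are nonnegative. *)
Lemma lagrange_coef_sign (R : realFieldType) (d : nat) (t : 'I_d.+1 -> R)
    (i : 'I_d.+1) (u : R) : (forall i j : 'I_d.+1, (i < j)%N -> t i < t j) ->
    t ord_max <= u ->
  0 <= (\prod_(j < d.+1 | (i < j)%N) -1) * lagrange_coef t i u.
Proof.
move=> t_mono tu.
have -> : \prod_(j < d.+1 | (i < j)%N) -1 =
    \prod_(j < d.+1 | j != i) (if (i < j)%N then -1 else 1 : R).
  rewrite -big_mkcondr; apply: eq_bigl => j.
  by rewrite -val_eqE /=; case: ltngtP.
rewrite -big_split /=; apply: prodr_ge0 => j ji.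
have tju : t j <= u.
  apply: le_trans tu; have [->//|jm] := eqVneq j ord_max.
  apply/ltW/t_mono; move: jm; rewrite -val_eqE /=; have := ltn_ord j; lia.
case: ltngtP ji => [ij _|ij _|/val_inj ->]; last by rewrite eqxx.
  by rewrite mulN1r -mulrN -invrN opprB divr_ge0 // subr_ge0 // ltW ?t_mono.
by rewrite mul1r divr_ge0 // subr_ge0 // ltW ?t_mono.
Qed.

(** Runs are abstracted away here: only the alternating nodes [t i] matter, every other point of [T]
    lying beyond the last node and sharing its sign. *)
Lemma simplex_of_alternating (R : realType) (d : nat) (T : {fset R})
    (xi : 'rV[R]_d.+1) (t : 'I_d.+1 -> R) :
    (forall i j : 'I_d.+1, (i < j)%N -> t i < t j) ->
    (forall i, t i \in T) ->
    (forall i j : 'I_d.+1, j = i.+1 :> nat ->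
      Num.sg (Defs.qpoly xi (t i)) = - Num.sg (Defs.qpoly xi (t j))) ->
    (forall u, u \in T -> Defs.qpoly xi u != 0) ->
    (forall u, u \in T -> (exists i, u = t i) \/
      (t ord_max <= u /\
       Num.sg (Defs.qpoly xi u) = Num.sg (Defs.qpoly xi (t ord_max)))) ->
  simplex d (convex_hull
    [set (Defs.qpoly xi u)^-1 *: veronese d u | u in [set` T]]).
Proof.
move=> t_mono tT alt q0 lastT.
have t_inj : injective t.
  move=> i j tij; apply: val_inj; case: (ltngtP i j) => // /t_mono;
  by rewrite tij ltxx.
pose q := Defs.qpoly xi.
pose v i := (q (t i))^-1 *: veronese d (t i).
exists v.
  move=> a _ a0 i.
  have : a i * (q (t i))^-1 = 0.
    apply: (veronese_free (b := fun i => a i * (q (t i))^-1) t_inj).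
    by rewrite -[RHS]a0; apply: eq_bigr => j _; rewrite scalerA.
  by move/eqP; rewrite mulf_eq0 invr_eq0 (negPf (q0 _ (tT i))) orbF => /eqP.
apply: convex_hull_eq => [_ [i _ <-]|_ [u /= uT <-]]; first by exists (t i) => //=.
case: (lastT u uT) => [[i ->]|[tu squ]].
  by apply: sub_gen_smallest; exists i.
(* The factor [q (t i)] undoes the normalization inside [v i]. *)
pose w i := lagrange_coef t i u * q (t i) / q u.
have -> : (Defs.qpoly xi u)^-1 *: veronese d u = \sum_i w i *: v i.
  (* The coordinate of index [k] is the interpolation formula for the monomial ['X^k]. *)
  apply/rowP => k; rewrite summxE !mxE -hornerXn.
  rewrite (lagrange_interpolation (t := t)) ?size_polyXn // mulr_sumr.
  apply: eq_bigr => i _; rewrite !mxE hornerXn /w.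
  rewrite [RHS]mulrA -[_ * (q (t i))^-1]mulrAC mulfK ?q0 // -mulrA mulrCA mulrA.
  by rewrite mulrC.
apply: convex_set_sum => [|i|i|].
- exact: convex_hull_convex.
(* Each value of [q] is split into sign and modulus; the common sign [s] cancels in the quotient and
   leaves the sign product [e]. *)
- rewrite /w [q (t i)]numEsg [q u]numEsg squ.
  rewrite (sgr_alternating (a := fun i => q (t i)) alt i).
  set e := \prod_(j < _ | _) _; set s := Num.sg _.
  have s0 : s != 0 by rewrite sgr_eq0 q0.
  have qu0 : `|q u| != 0 by rewrite normr_eq0 q0.
  rewrite (_ : _ / _ = e * lagrange_coef t i u * (`|q (t i)| / `|q u|)).
    by rewrite mulr_ge0 ?divr_ge0 // lagrange_coef_sign.
  by field; rewrite qu0 s0.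
- by apply: sub_gen_smallest; exists i.
- rewrite -mulr_suml; apply: (canLR (mulfK (q0 _ uT))); rewrite mul1r.
  pose p := \poly_(k < d.+1) xi 0 (inord k).
  have pE x : q x = p.[x].
    rewrite horner_poly; apply: eq_bigr => k _.
    by rewrite inord_val.
  rewrite -/(q u) pE (lagrange_interpolation (t := t)) ?size_poly //.
  by apply: eq_bigr => i _; rewrite pE.
Qed.

Theorem theorem3p18 (R : realType) (d n : nat) (T : {fset R})
    (sigma P : set 'rV[R]_d.+1) (I : 'I_d.+1 -> {fset R})
    (d_ge3 : (3 <= d)%N) (card_T : #|` T| = n) (n_ge : (d.+1 <= n)%N)
    (sigma_chamber : chamber T sigma)
    (P_sigmaT : veronese_polytope T sigma P)
    (I_decomposition : signed_decomposition T sigma I)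
    (card_I : forall i : 'I_d.+1, (i < d)%N -> #|` I i| = 1%N)
    (card_I_last : #|` I ord_max| = (n - d)%N) :
  simplex d P.
Proof.
have [s s0 sgs] := chamber_sgr sigma_chamber.
have [xi' xi'sigma [runI allI ltI]] := I_decomposition.
have [xi xisigma ->] := P_sigmaT.
have IT i : {subset I i <= T} by case: (runI i) => -[_ /fsubsetP].
have sgE u : u \in T -> Num.sg (Defs.qpoly xi u) = Num.sg (Defs.qpoly xi' u).
  by move=> uT; rewrite (sgs xi) ?(sgs xi').
(* The node of each run is its least element, so that the last run lies at or beyond the last
   node. *)
have min_I i : exists2 m, m \in I i & forall u, u \in I i -> m <= u.
  have [[/fset0Pn[a aI] _ _ _] _] := runI i.
  case: (arg_minP (fun u : I i => fsval u) (erefl : predT [` aI]%fset)) => m _ minm.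
  by exists (fsval m) => [|u uI]; [exact: fsvalP|exact: (minm [` uI]%fset)].
pose t i := s2val (cid2 (min_I i)).
have tI i : t i \in I i by rewrite /t; case: cid2.
have t_min i u : u \in I i -> t i <= u by rewrite /t; case: cid2 => m /= _; apply.
have q0 u : u \in T -> Defs.qpoly xi u != 0.
  by move=> uT; rewrite -sgr_eq0 sgs //; exact: s0.
apply: (simplex_of_alternating (t := t)) => //.
- by move=> i j /ltI; apply.
- by move=> i; apply: IT (tI i).
- move=> i j ji.
  have := adjacent_runs_neq_sg runI allI ltI ji (tI i) (tI j).
  rewrite -!sgE; try exact: IT (tI _).
  (* Both values are nonzero, so distinct signs are opposite. *)
  move: (q0 _ (IT _ _ (tI i))) (q0 _ (IT _ _ (tI j))).
  by rewrite !neq_lt => /orP[/ltr0_sg|/gtr0_sg] -> /orP[/ltr0_sg|/gtr0_sg] -> //;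
    rewrite ?opprK // ?ltxx.
move=> u uT; have [_ /allI[i ->] ui] := maximal_sign_run_cover xi' uT.
have [id|di] := ltnP i d.
  left; exists i; have /eqP/cardfs1P[a Ia] := card_I i id.
  by move: ui (tI i); rewrite Ia !in_fset1 => /eqP -> /eqP ->.
right; have {di}im : i = ord_max.
  by apply: val_inj => /=; apply/eqP; rewrite eqn_leq di -ltnS ltn_ord.
rewrite im in ui; split; first exact: t_min.
rewrite !sgE //; last exact: IT (tI _).
by have [[_ _ _ /(_ u _ ui (tI _))]] := runI ord_max.
Qed.
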